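(* Let $m=2$. For generic $c\in\mathbb{C}^n$, \[\mathrm{rank}_p(\mathrm{Horn}(\mathcal{B},c))=\sum\nu_{ij},\] where the sum runs over unordered pairs $\{i,j\}$ of rows $b_i,b_j$ of $\mathcal{B}$ that are linearly independent and lie in the interiors of opposite quadrants of $\mathbb{Z}^2$.
   Context: $\mathcal{B}=(b_{ji})\in\mathbb{Z}^{n\times 2}$ ($n>2$) has rank 2, rows $b_j$ summing to zero. $\mathrm{Horn}(\mathcal{B},c)=D_2\langle H_1,H_2\rangle$, $H_i=Q_i-y_iP_i$, $P_i=\prod_{j:b_{ji}<0}\prod_{l=0}^{|b_{ji}|-1}(b_j\cdot\theta_y+c_j-l)$, $Q_i=\prod_{j:b_{ji}>0}\prod_{l=0}^{b_{ji}-1}(b_j\cdot\theta_y+c_j-l)$, $b_j\cdot\theta_y=b_{j1}y_1\partial_{y_1}+b_{j2}y_2\partial_{y_2}$. $\mathrm{rank}_p$ is the dimension of the space of Puiseux polynomial solutions (finite linear combinations of monomials with complex exponents). $\nu_{ij}=\min(|b_{i1}b_{j2}|,|b_{j1}b_{i2}|)$ when $b_i,b_j$ lie in the interiors of opposite quadrants. Generic: outside an exceptional measure-zero set. *)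

(* Defs.v *)
From HB Require Import structures.
From mathcomp Require Import all_boot all_order all_algebra.
From mathcomp Require Import reals.
From mathcomp Require Import complex.

Set Implicit Arguments.
Unset Strict Implicit.
Unset Printing Implicit Defensive.

Import Order.TTheory GRing.Theory Num.Theory.
Local Open Scope ring_scope.

Section Horn.
Variable R : realType.
Local Notation C := (R[i]).

Definition in_box (n : nat) (lo hi : 'I_n -> C) (c : 'I_n -> C) : Prop :=
  forall j, (complex.Re (lo j) <= complex.Re (c j) <= complex.Re (hi j))
         /\ (complex.Im (lo j) <= complex.Im (c j) <= complex.Im (hi j)).

Definition box_vol (n : nat) (lo hi : 'I_n -> C) : R :=
  \prod_(j < n) ((complex.Re (hi j) - complex.Re (lo j)) *
                 (complex.Im (hi j) - complex.Im (lo j))).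

Definition null_set (n : nat) (E : ('I_n -> C) -> Prop) : Prop :=
  forall eps : R, 0 < eps ->
    exists lo hi : nat -> 'I_n -> C,
      (forall k j, complex.Re (lo k j) <= complex.Re (hi k j) /\
                   complex.Im (lo k j) <= complex.Im (hi k j)) /\
      (forall c, E c -> exists k, in_box (lo k) (hi k) c) /\
      (forall N, \sum_(k < N) box_vol (lo k) (hi k) < eps).

(* A Puiseux polynomial sum_a f(a) y^a (a in C^2) is represented by   *)
(* its finitely supported coefficient function f : C * C -> C.        *)
(* theta_y_i acts on y^a by multiplication by a_i, and y_i shifts the *)
(* exponent by e_i.                                                   *)
Variable n : nat.

Definition horn_lin (B : 'M[int]_(n, 2)) (c : 'I_n -> C) (j : 'I_n) (a : C * C) : C :=
  (B j 0)%:~R * a.1 + (B j 1)%:~R * a.2 + c j.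

Definition horn_Q (B : 'M[int]_(n, 2)) (c : 'I_n -> C) (i : 'I_2) (a : C * C) : C :=
  \prod_(j < n | (0 < B j i)%R)
    \prod_(l < `|B j i|%N) (horn_lin B c j a - l%:R).

Definition horn_P (B : 'M[int]_(n, 2)) (c : 'I_n -> C) (i : 'I_2) (a : C * C) : C :=
  \prod_(j < n | (B j i < 0)%R)
    \prod_(l < `|B j i|%N) (horn_lin B c j a - l%:R).

Definition shift (i : 'I_2) (a : C * C) : C * C :=
  if i == 0 then (a.1 - 1, a.2) else (a.1, a.2 - 1).

(* coefficient function of H_i f = Q_i f - y_i P_i f *)
Definition horn_H (B : 'M[int]_(n, 2)) (c : 'I_n -> C) (i : 'I_2)
    (f : C * C -> C) : C * C -> C :=
  fun a => horn_Q B c i a * f a - horn_P B c i (shift i a) * f (shift i a).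

Definition puiseux_poly (f : C * C -> C) : Prop :=
  exists s : seq (C * C), forall a, f a != 0 -> a \in s.

Definition puiseux_sol (B : 'M[int]_(n, 2)) (c : 'I_n -> C) (f : C * C -> C) : Prop :=
  puiseux_poly f /\ forall i a, horn_H B c i f a = 0.

Definition rank_p_is (B : 'M[int]_(n, 2)) (c : 'I_n -> C) (N : nat) : Prop :=
  exists F : 'I_N -> (C * C -> C),
    (forall k, puiseux_sol B c (F k)) /\
    (forall lam : 'I_N -> C,
        (forall a, \sum_(k < N) lam k * F k a = 0) -> forall k, lam k = 0) /\
    (forall f, puiseux_sol B c f ->
        exists lam : 'I_N -> C, forall a, f a = \sum_(k < N) lam k * F k a).

End Horn.
Local Open Scope ring_scope.

Definition opp_quadrants (n : nat) (B : 'M[int]_(n, 2)) (i j : 'I_n) : bool :=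
  [&& (B i 0 != 0)%R, (B i 1 != 0)%R,
      (sgz (B j 0) == - sgz (B i 0))%R & (sgz (B j 1) == - sgz (B i 1))%R].

Definition lin_indep_rows (n : nat) (B : 'M[int]_(n, 2)) (i j : 'I_n) : bool :=
  B i 0 * B j 1 - B i 1 * B j 0 != 0.

Definition nu (n : nat) (B : 'M[int]_(n, 2)) (i j : 'I_n) : nat :=
  minn `|(B i 0 * B j 1)%R|%N `|(B j 0 * B i 1)%R|%N.

Definition nu_sum (n : nat) (B : 'M[int]_(n, 2)) : nat :=
  \sum_(i < n) \sum_(j < n | (i < j)%N && lin_indep_rows B i j && opp_quadrants B i j)
     nu B i j.

(* Main.v *)
(* Write [lam j a = b_j . a + c_j].  On coefficient functions the Horn system is a
   first-order recurrence along the edges of [a + Z^2], and an edge coefficient vanishes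
   exactly when some [lam j] crosses between the negative and the nonnegative integers.
   Hence a finite support can be left in none of the four axis directions, and for generic
   [c] (no integer relation among the [c_j] and 1, so that at most two independent [lam j]
   are integers at any point) this forces exactly two rows [b_j], [b_k], in opposite
   quadrants, to have [lam j], [lam k] in [N].

   In the coordinates [(u, v) = (lam j, lam k)] the edges become the steps
   [(u - p, v + r)] and [(u + q, v - s)] of [N^2], and the axes can be named so that
   [p s < q r].  Then both steps increase a positive weight, and they commute, so every
   finite connected component contains exactly one point of the box
   [u < p], [v < s], and each point of the box has a finite component.  The restriction
   of [1 / \prod_l Gamma (lam_l + 1)] to such a component is a solution; these form a basis,
   and there are [p s = nu_jk] of them for each pair. *)

Require Import Defs.
From HB Require Import structures.
From mathcomp Require Import all_boot all_order all_algebra.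
From mathcomp Require Import reals.
From mathcomp Require Import complex.
From mathcomp Require Import boolp zify ring lra.
Set Implicit Arguments.
Unset Strict Implicit.
Unset Printing Implicit Defensive.
Import Order.TTheory GRing.Theory Num.Theory.
Local Open Scope ring_scope.

(** * Null sets *)

Lemma ler_sum_uniq_sub (R : numDomainType) (I : eqType) (F : I -> R) (s t : seq I) :
    (forall i, 0 <= F i) -> uniq s -> uniq t -> {subset s <= t} ->
  \sum_(i <- s) F i <= \sum_(i <- t) F i.
Proof.
move=> F0 us ut st.
rewrite [X in _ <= X](bigID (mem s)) /= -[X in _ <= X + _]big_filter.
have -> : \sum_(i <- s) F i = \sum_(i <- [seq i <- t | i \in s]) F i.
  apply: perm_big; apply: uniq_perm => //; first exact: filter_uniq.
  by move=> i; rewrite mem_filter; case: (boolP (i \in s)) => // /st ->.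
by rewrite lerDl sumr_ge0.
Qed.

Lemma sum_half_powers (R : realFieldType) (N : nat) :
  \sum_(i <- iota 0 N) (2^-1 : R) ^+ i.+1 = 1 - 2^-1 ^+ N.
Proof.
rewrite -[N in iota _ N]subn0 -/(index_iota 0 N).
elim: N => [|N IH]; first by rewrite big_nil expr0 subrr.
by rewrite big_nat_recr //= IH exprS; field.
Qed.

Lemma sum_half_pickle (R : realFieldType) (I : countType) (s : seq I) :
  uniq s -> \sum_(i <- s) (2^-1 : R) ^+ (pickle i).+1 < 1.
Proof.
move=> us; rewrite -(big_map pickle predT (fun x : nat => (2^-1 : R) ^+ x.+1)) /=.
pose N := (\max_(i <- s) pickle i).+1.
apply: (@le_lt_trans _ _ (\sum_(i <- iota 0 N) (2^-1 : R) ^+ i.+1)).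
  apply: ler_sum_uniq_sub; rewrite ?iota_uniq ?(map_inj_uniq (pcan_inj pickleK)) //.
    by move=> i; rewrite exprn_ge0 // invr_ge0 ler0n.
  move=> _ /mapP[i si ->]; rewrite mem_iota /= add0n ltnS.
  exact: leq_bigmax_seq.
by rewrite sum_half_powers ltrBlDr ltrDl exprn_gt0 // invr_gt0 ltr0n.
Qed.

Section NullSets.
Variables (R : realType) (n : nat).
Local Notation C := (R[i]).
Implicit Types (lo hi c : 'I_n -> C) (E : ('I_n -> C) -> Prop).

Definition box_le lo hi := forall j,
  complex.Re (lo j) <= complex.Re (hi j) /\ complex.Im (lo j) <= complex.Im (hi j).

Lemma box_vol_ge0 lo hi : box_le lo hi -> 0 <= box_vol lo hi.
Proof.
by move=> h; apply: prodr_ge0 => j _; case: (h j) => h1 h2; rewrite mulr_ge0 ?subr_ge0.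
Qed.

(** Frees covers from the indexing by [nat]. A number that codes no index gets a one-point box, of
    volume 0 because the product has a factor at [k0]. *)
Lemma null_set_countable_cover (k0 : 'I_n) E :
    (forall eps : R, 0 < eps -> exists (I : countType) (lo hi : I -> 'I_n -> C),
      [/\ forall i, box_le (lo i) (hi i),
          forall c, E c -> exists i, in_box (lo i) (hi i) c
        & forall s : seq I, uniq s -> \sum_(i <- s) box_vol (lo i) (hi i) < eps]) ->
  null_set E.
Proof.
move=> H eps e0; have [I [lo [hi [le_box cov vol]]]] := H eps e0.
pose dec (b : I -> 'I_n -> C) x := if pickle_inv x is Some i then b i else fun=> 0.
exists (dec lo), (dec hi); split; [|split].
- by move=> k; rewrite /dec; case: pickle_inv => [i|//]; apply: le_box.
- by move=> c /cov[i ci]; exists (pickle i); rewrite /dec pickleK_inv.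
move=> N; apply: le_lt_trans (vol (pmap pickle_inv (iota 0 N)) _); last first.
  by apply: (pmap_uniq (@pickle_invK I)); apply: iota_uniq.
rewrite -(big_mkord predT (fun k => box_vol (dec lo k) (dec hi k))) /index_iota subn0.
elim: (iota 0 N) => [|x s IH] /=; first by rewrite !big_nil.
rewrite big_cons /= {1 2}/dec; case: pickle_inv => [i|] /=.
  by rewrite big_cons lerD2l.
by rewrite /box_vol (bigD1 k0) //= subrr !mul0r add0r.
Qed.

Lemma null_set_bigcup (k0 : 'I_n) (D : countType) (E : D -> ('I_n -> C) -> Prop) :
  (forall d, null_set (E d)) -> null_set (fun c => exists d, E d c).
Proof.
move=> nullE; apply: (null_set_countable_cover k0) => eps e0.
have wt d : exists b : (nat -> 'I_n -> C) * (nat -> 'I_n -> C),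
    [/\ forall k, box_le (b.1 k) (b.2 k),
        forall c, E d c -> exists k, in_box (b.1 k) (b.2 k) c
      & forall N, \sum_(k < N) box_vol (b.1 k) (b.2 k) < eps * 2^-1 ^+ (pickle d).+1].
  have e1 : 0 < eps * 2^-1 ^+ (pickle d).+1 by rewrite mulr_gt0 // exprn_gt0 // invr_gt0.
  by have [lo [hi [? [? ?]]]] := nullE d _ e1; exists (lo, hi).
have [b bP] := choice wt.
pose vol (i : D * nat) := box_vol ((b i.1).1 i.2) ((b i.1).2 i.2).
have vol0 i : 0 <= vol i by apply: box_vol_ge0; case: (bP i.1).
exists (D * nat)%type, (fun i => (b i.1).1 i.2), (fun i => (b i.1).2 i.2); split.
- by move=> [d k]; case: (bP d).
- by move=> c [d Ec]; have [_ cov _] := bP d; have [k ck] := cov c Ec; exists (d, k).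
move=> s us; rewrite -/(vol _).
(* A finite set of pairs lies in a rectangle, so partial sums over [k], each within the share of
   [eps] allotted to [d], bound the whole. *)
pose ds := undup [seq i.1 | i <- s]; pose M := (\max_(i <- s) i.2).+1.
have sub : {subset s <= [seq (d, k) | d <- ds, k <- iota 0 M]}.
  move=> [d k] sdk; apply: allpairs_f.
    by rewrite mem_undup; apply/mapP; exists (d, k).
  by rewrite mem_iota /= add0n ltnS (@leq_bigmax_seq _ s predT snd (d, k)).
apply: le_lt_trans (ler_sum_uniq_sub vol0 us _ sub) _.
  by rewrite allpairs_uniq ?undup_uniq ?iota_uniq // => -[d k] [d' k'].
rewrite big_allpairs_dep /=.
apply: (@le_lt_trans _ _ (\sum_(d <- ds) eps * 2^-1 ^+ (pickle d).+1)).
  apply: ler_sum => d _; have [_ _ /(_ M)/ltW] := bP d.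
  by rewrite -(big_mkord predT (fun k => vol (d, k))) /index_iota subn0.
by rewrite -mulr_sumr gtr_pMr // sum_half_pickle // undup_uniq.
Qed.

End NullSets.

(** * Integer affine hyperplanes *)

Section Hyperplanes.
Variables (R : realType) (n : nat).
Local Notation C := (R[i]).

Lemma Re_intM (m : int) (z : C) : complex.Re (m%:~R * z) = m%:~R * complex.Re z.
Proof.
rewrite -(rmorph_int (@real_complex R)); case: z => x y /=.
by rewrite mul0r subr0.
Qed.

Lemma Re_int (m : int) : complex.Re (m%:~R : C) = m%:~R.
Proof. by rewrite -[m%:~R]mulr1 Re_intM mulr1. Qed.

Lemma Re_sum (I : Type) (r : seq I) (F : I -> C) :
  complex.Re (\sum_(i <- r) F i) = \sum_(i <- r) complex.Re (F i).
Proof. by apply: (big_morph (@complex.Re R)) => [[? ?] [? ?]|]. Qed.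

Lemma grid_cell (K d x : R) (L : nat) : 0 < d -> d * L%:R = 2 * K -> `|x| < K ->
  exists i : 'I_L, - K + d * i%:R <= x <= - K + d * i%:R + d.
Proof.
move=> d0 dL; rewrite ltr_norml => /andP[x1 x2].
have y0 : 0 <= (x + K) / d by rewrite divr_ge0 ?ltW //; lra.
have yL : (x + K) / d < L%:R by rewrite ltr_pdivrMr // mulrC dL; lra.
have /andP[t1 t2] := Num.Theory.truncn_itv y0.
have iL : (Num.truncn ((x + K) / d) < L)%N by rewrite -(ltr_nat R) (le_lt_trans t1).
exists (Ordinal iL) => /=; move: (Num.truncn _) t1 t2 {iL yL} => i.
rewrite ler_pdivlMr // ltr_pdivrMr // -natr1 mulrDl mul1r mulrC => h1 h2; lra.
Qed.

(** The real part of the equation determines [Re (c k)] up to [S * d] once the other real parts are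
    known up to [d]. Cutting the other real coordinates into [L] intervals gives boxes of total
    volume [A / L]. *)
Lemma null_hyperplane_bounded (v : 'I_n -> int) (m : int) (k : 'I_n) (M : nat) :
  v k != 0 ->
  null_set (fun c : 'I_n -> C => \sum_j (v j)%:~R * c j = m%:~R /\
    forall j, `|complex.Re (c j)| < M.+1%:R /\ `|complex.Im (c j)| < M.+1%:R).
Proof.
move=> vk; apply: (null_set_countable_cover k) => eps e0.
pose K : R := M.+1%:R; have K0 : 0 < K by rewrite ltr0n.
pose S : R := \sum_j `|(v j)%:~R|; have S0 : 0 <= S by apply: sumr_ge0.
pose A : R := (2 * S * (2 * K)) * (2 * K) * \prod_(j < n | j != k) (4 * K ^+ 2).
have A0 : 0 <= A.
  by rewrite mulr_ge0 ?prodr_ge0 // => *; rewrite ?mulr_ge0 ?exprn_ge0 // ltW.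
pose L := (Num.truncn (A / eps)).+1.
have L0 : 0 < L%:R :> R by rewrite ltr0n.
have AL : A / L%:R < eps.
  have /andP[_] := Num.Theory.truncn_itv (divr_ge0 A0 (ltW e0)).
  by rewrite ltr_pdivrMr // ltr_pdivrMr // mulrC.
pose d := 2 * K / L%:R; have d0 : 0 < d by rewrite divr_gt0 // mulr_gt0.
have dL : d * L%:R = 2 * K by rewrite mulfVK // gt_eqF.
pose T := {ffun 'I_n -> 'I_L * 'I_L}.
pose ctr (g : T) := (m%:~R - \sum_(j | j != k) (v j)%:~R * (- K + d * (g j).1%:R))
                      / (v k)%:~R.
(* Since [Re (c k)] is fixed by the other cells, only index 0 in its slot carries a box; any other
   index gives volume 0. *)
pose lo (g : T) j : C := Complex
  (if j == k then if (g k).1 == 0 :> nat then ctr g - S * d else 0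
   else - K + d * (g j).1%:R) (- K + d * (g j).2%:R).
pose hi (g : T) j : C := Complex
  (if j == k then if (g k).1 == 0 :> nat then ctr g + S * d else 0
   else - K + d * (g j).1%:R + d) (- K + d * (g j).2%:R + d).
have le_box g : box_le (lo g) (hi g).
  have Sd : 0 <= S * d by rewrite mulr_ge0 // ltW.
  by move=> j; rewrite /lo /hi /=; do 2?case: ifP => _; split; lra.
exists T, lo, hi; split=> //.
- move=> c [ceq cM].
  have cell j : exists x : 'I_L * 'I_L,
     - K + d * x.1%:R <= complex.Re (c j) <= - K + d * x.1%:R + d /\
     - K + d * x.2%:R <= complex.Im (c j) <= - K + d * x.2%:R + d.
    case: (cM j) => /(grid_cell d0 dL)[x1 h1] /(grid_cell d0 dL)[x2 h2].
    by exists (x1, x2).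
  have [h hP] := choice cell.
  exists [ffun j => if j == k then (ord0, (h j).2) else h j] => j.
  rewrite /lo /hi /= !ffunE; case: (hP j) => h1 h2.
  case: eqP => [jk|/eqP jk] /=; last by split.
  subst j; rewrite eqxx /=; split=> //.
  have vk0 : (v k)%:~R != 0 :> R by rewrite intr_eq0.
  have cE : complex.Re (c k) =
      (m%:~R - \sum_(j | j != k) (v j)%:~R * complex.Re (c j)) / (v k)%:~R.
    rewrite -[m%:~R]Re_int -ceq Re_sum (bigD1 k) //= Re_intM.
    rewrite (eq_bigr _ (fun j _ => Re_intM (v j) (c j))).
    by rewrite addrK mulrC mulKf.
  suff: `|complex.Re (c k) - ctr [ffun j => if j == k then (ord0, (h j).2) else h j]|
          <= S * d by rewrite ler_norml => /andP[? ?]; lra.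
  rewrite cE /ctr -mulrBl opprB addrC addrA subrK -sumrB normrM.
  rewrite normfV ler_pdivrMr ?normr_gt0 //.
  have v1 : 1 <= `|(v k)%:~R| :> R.
    by rewrite -intr_norm (_ : 1 = 1%:~R) // ler_int -gtz0_ge1 normr_gt0.
  apply: (@le_trans _ _ (S * d)); last by rewrite ler_peMr // mulr_ge0 // ltW.
  apply: le_trans (ler_norm_sum _ _ _) _.
  rewrite /S [X in _ <= X * _](bigD1 k) //= mulrDl -[X in X <= _]add0r.
  apply: lerD; first by rewrite mulr_ge0 // ltW.
  rewrite mulr_suml; apply: ler_sum => i ik.
  rewrite -mulrBr normrM ler_wpM2l // ffunE (negbTE ik).
  by case: (hP i) => /andP[? ?] _; rewrite ler_norml; lra.
pose w j (x : 'I_L * 'I_L) : R :=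
  (if j == k then if x.1 == 0 :> nat then 2 * S * d else 0 else d) * d.
have volE g : box_vol (lo g) (hi g) = \prod_j w j (g j).
  apply: eq_bigr => j _; rewrite /lo /hi /w /=.
  by case: eqP => [->|_]; [case: eqP => _; ring | ring].
move=> s us; apply: le_lt_trans AL.
apply: (@le_trans _ _ (\sum_(g <- enum T) box_vol (lo g) (hi g))).
  apply: ler_sum_uniq_sub; rewrite ?enum_uniq // => g; last by rewrite mem_enum.
  exact: box_vol_ge0.
(* The sum over all [g] factors into a product over the coordinates of sums over the cells. *)
rewrite big_enum /= (eq_bigr _ (fun g _ => volE g)) -(bigA_distr_bigA w).
rewrite (bigD1 k) //= /A mulrAC.
have -> : \sum_x w k x = 2 * S * (2 * K) * (2 * K) / L%:R.
  rewrite -(pair_bigA _ (fun x1 x2 => w k (x1, x2))) /= (bigD1 ord0) //= [X in _ + X]big1.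
    rewrite /w /= eqxx sumr_const card_ord addr0 -[_ *+ L]mulr_natr.
    rewrite -mulrA dL /d; ring.
  move=> i i0; apply: big1 => x _; rewrite /w /= eqxx ifF ?mul0r //.
  by apply: contra_neqF i0 => /eqP i0; apply: val_inj.
rewrite [X in _ * X <= _](eq_bigr (fun=> 4 * K ^+ 2)); first by rewrite mulrAC.
move=> j jk; rewrite /w (negbTE jk) /= sumr_const card_prod !card_ord -[LHS]mulr_natr natrM.
by rewrite mulrACA dL; ring.
Qed.

Definition integer_relation (c : 'I_n -> C) :=
  exists v : {ffun 'I_n -> int}, v != 0 /\ exists m : int, \sum_j (v j)%:~R * c j = m%:~R.

(** Marking a nonzero coefficient [k] and a bound [M] on [c] splits the relations into countably
    many bounded pieces of hyperplanes. *)
Lemma null_integer_relation (k0 : 'I_n) : null_set integer_relation.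
Proof.
pose D := ({ffun 'I_n -> int} * 'I_n * int * nat)%type.
pose E (d : D) (c : 'I_n -> C) := let: (v, k, m, M) := d in v k != 0 /\
   (\sum_j (v j)%:~R * c j = m%:~R /\
    forall j, `|complex.Re (c j)| < M.+1%:R /\ `|complex.Im (c j)| < M.+1%:R).
have nullE d : null_set (E d).
  case: d => [[[v k] m] M]; have [vk|vk] := boolP (v k != 0); last first.
    (* [E d] is empty here; the boxes of an arbitrary hyperplane serve. *)
    move=> eps e0; have [lo [hi [h1 [_ h3]]]] :=
      @null_hyperplane_bounded (fun=> 1) 0 k 0 isT eps e0.
    by exists lo, hi; split=> //; split=> // c []; rewrite (negbTE vk).
  move=> eps e0; have [lo [hi [h1 [h2 h3]]]] := @null_hyperplane_bounded v m k M vk eps e0.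
  by exists lo, hi; split=> //; split=> // c [_]; apply: h2.
move=> eps e0; have [lo [hi [h1 [h2 h3]]]] := null_set_bigcup k0 nullE e0.
exists lo, hi; split=> //; split=> // c [v [v0 [m cm]]]; apply: h2.
have [k vk] : exists k, v k != 0.
  apply/existsP; apply: contra_neqT v0; rewrite negb_exists => /forallP v0.
  by apply/ffunP => j; rewrite ffunE; apply/eqP; rewrite -[_ == _]negbK.
pose F j := (Num.truncn `|complex.Re (c j)| + Num.truncn `|complex.Im (c j)|)%N.
pose M := \max_j F j.
exists (v, k, m, M); split=> //; split=> // j.
have FM : (F j <= M)%N by apply: leq_bigmax.
by split; apply: lt_le_trans (Num.Theory.truncnS_gt _) _; rewrite ler_nat ltnS;
  apply: leq_trans FM; rewrite /F ?leq_addr ?leq_addl.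
Qed.

End Hyperplanes.

(** * Steps in the quarter plane *)

Section Rewriting.
Variables (p q r s : nat).
Implicit Types (t w : nat * nat).

(** Subtraction truncates; each use is guarded by [p <= w.1] or [s <= w.2]. *)
Definition move1 w := (w.1 - p, w.2 + r)%N.
Definition move2 w := (w.1 + q, w.2 - s)%N.
Definition terminal t := (t.1 < p)%N && (t.2 < s)%N.

Fixpoint reach n t w : bool :=
  if n is n'.+1 then
    (p <= w.1)%N && reach n' t (move1 w) || (s <= w.2)%N && reach n' t (move2 w)
  else w == t.

Definition reaches t w := exists n, reach n t w.

(** Chosen so that both moves raise it by the same amount [q * r - p * s]. *)
Definition weight w := ((r + s) * w.1 + (p + q) * w.2)%N.

(** Neither move lowers the coordinate that guards the other, and the moves commute. As [t] admits
    no move, any available move can begin a path to [t] of the same length. *)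
Lemma reach_diamond n t w : terminal t -> reach n t w ->
  ((p <= w.1)%N -> exists2 m, n = m.+1 & reach m t (move1 w)) /\
  ((s <= w.2)%N -> exists2 m, n = m.+1 & reach m t (move2 w)).
Proof.
move=> /andP[t1 t2]; elim: n w => [|n IH] w /=.
  by move/eqP->; split=> h; [move: t1 | move: t2]; rewrite ltnNge h.
have comm : (p <= w.1)%N -> (s <= w.2)%N -> move1 (move2 w) = move2 (move1 w).
  by move=> h1 h2; rewrite /move1 /move2 /=; congr pair; lia.
case/orP => /andP[h hn]; split=> h'; try by exists n.
- have h2 : (s <= (move1 w).2)%N by rewrite (leq_trans h') ?leq_addr.
  have [_ /(_ h2)[m -> hm]] := IH _ hn.
  by exists m.+1 => //=; rewrite comm // hm (leq_trans h) ?leq_addr.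
- have h1 : (p <= (move2 w).1)%N by rewrite (leq_trans h') ?leq_addr.
  have [/(_ h1)[m -> hm] _] := IH _ hn.
  by exists m.+1 => //=; rewrite -comm // hm (leq_trans h) ?leq_addr ?orbT.
Qed.

(** Reaching [t] is thus invariant along edges in both directions: the points that reach [t] form a
    whole connected component. *)
Lemma reaches_move1 t w : terminal t -> (p <= w.1)%N ->
  reaches t (move1 w) <-> reaches t w.
Proof.
move=> tt pw; split=> [[n hn]|[n /(reach_diamond tt)[/(_ pw)[m _ hm] _]]].
  by exists n.+1; rewrite /= pw hn.
by exists m.
Qed.

Lemma reaches_move2 t w : terminal t -> (s <= w.2)%N ->
  reaches t (move2 w) <-> reaches t w.
Proof.
move=> tt sw; split=> [[n hn]|[n /(reach_diamond tt)[_ /(_ sw)[m _ hm]]]].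
  by exists n.+1; rewrite /= sw hn orbT.
by exists m.
Qed.

Lemma reaches_terminal t w : terminal w -> reaches t w -> w = t.
Proof.
move=> /andP[w1 w2] [[|n]] /=; first by move/eqP.
by rewrite leqNgt w1 leqNgt w2.
Qed.

Hypothesis slopes : (p * s < q * r)%N.

Lemma weight_move1 w : (p <= w.1)%N -> (weight w < weight (move1 w))%N.
Proof. by rewrite /weight /=; nia. Qed.

Lemma weight_move2 w : (s <= w.2)%N -> (weight w < weight (move2 w))%N.
Proof. by rewrite /weight /=; nia. Qed.

Lemma reaches_weight t w : reaches t w -> (weight w <= weight t)%N.
Proof.
case=> n; elim: n w => [|n IH] w /=; first by move/eqP->.
case/orP => /andP[h /IH]; apply: leq_trans; apply: ltnW.
  exact: weight_move1.
exact: weight_move2.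
Qed.

End Rewriting.

(** * Solutions and their supports *)

Section InvGamma.
Variable K : fieldType.

(* [invgamma z m] is [Gamma (z + 1) / Gamma (z + m + 1)] as long as no factor vanishes. *)
Definition invgamma (z : K) (m : int) : K :=
  match m with
  | Posz m => \prod_(i < m) (z + i.+1%:R)^-1
  | Negz m => \prod_(i < m.+1) (z - i%:R)
  end.

Lemma invgamma_pred z (m : int) : (forall i : nat, z + i.+1%:R != 0) ->
  invgamma z (m - 1) = (z + m%:~R) * invgamma z m.
Proof.
move=> z0; case: m => [[|m]|m].
- by rewrite /= big_ord1 big_ord0 subr0 addr0 mulr1.
- rewrite (_ : Posz m.+1 - 1 = Posz m); last by lia.
  by rewrite /= big_ord_recr /= -pmulrn mulrCA mulfV // mulr1.
rewrite (_ : Negz m - 1 = Negz m.+1); last by lia.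
by rewrite /= big_ord_recr /= mulrC NegzE mulrNz.
Qed.

Lemma invgamma_sub z (m : int) (k : nat) : (forall i : nat, z + i.+1%:R != 0) ->
  invgamma z (m - k%:Z) = \prod_(l < k) (z + m%:~R - l%:R) * invgamma z m.
Proof.
move=> z0; elim: k => [|k IH]; first by rewrite subr0 big_ord0 mul1r.
rewrite (_ : m - k.+1%:Z = m - k%:Z - 1); last by lia.
rewrite invgamma_pred // IH big_ord_recr /= mulrA; congr (_ * _).
by rewrite rmorphB /= mulrC addrA.
Qed.

End InvGamma.

Lemma ord2P (i : 'I_2) : i = 0 \/ i = 1.
Proof. by case: i => [[|[|[]]]] // h; [left | right]; apply: val_inj. Qed.

Section Solutions.
Variables (R : realType) (n : nat) (B : 'M[int]_(n, 2)) (c : 'I_n -> R[i]).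
Local Notation C := (R[i]).
Local Notation lam := (horn_lin B c).
Implicit Types (a : C * C) (i : 'I_2) (j k l : 'I_n) (sg : int) (f : C * C -> C).

Definition translate i (m : int) a : C * C :=
  if i == 0 then (a.1 + m%:~R, a.2) else (a.1, a.2 + m%:~R).

Lemma shiftE i a : shift i a = translate i (- 1) a.
Proof. by rewrite /shift /translate !mulrN1z. Qed.

Lemma translateD i (x y : int) a : translate i x (translate i y a) = translate i (x + y) a.
Proof. by rewrite /translate; case: eqP => _ /=; rewrite rmorphD /= -addrA [_ + x%:~R]addrC. Qed.

Lemma translate0 i a : translate i 0 a = a.
Proof. by rewrite /translate !addr0; case: eqP; case: a. Qed.

Lemma translate_inj i a : injective (translate i ^~ a).
Proof.
by move=> x y; rewrite /translate; case: eqP => _ [] /addrI /intr_inj.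
Qed.

Lemma lam_translate j i (m : int) a : lam j (translate i m a) = lam j a + (B j i * m)%:~R.
Proof.
by rewrite /horn_lin /translate; case: (ord2P i) => -> /=; rewrite rmorphM /=; ring.
Qed.

Definition signs sg := sg = 1 \/ sg = -1.

Lemma prod_lam_eq0 (P : pred 'I_n) i a :
  reflect (exists j (m : nat), [/\ P j, (m < `|B j i|)%N & lam j a = m%:R])
    (\prod_(j | P j) \prod_(l < `|B j i|) (lam j a - l%:R) == 0).
Proof.
apply: (iffP idP) => [|[j [m [Pj mB lm]]]].
  case/prodf_eq0 => j Pj /prodf_eq0[l _]; rewrite subr_eq0 => /eqP lm.
  by exists j, l.
by rewrite (bigD1 j) //= (bigD1 (Ordinal mB)) //= lm subrr !mul0r.
Qed.

(** As [m] is natural, the inequality encodes both [B j i < 0] and [m < |B j i|]. *)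
Lemma horn_P_eq0 i a :
  horn_P B c i a = 0 <-> exists j (m : nat), lam j a = m%:R /\ m%:Z + B j i < 0.
Proof.
split=> [/eqP/prod_lam_eq0[j [m [? ? ?]]]|[j [m [? ?]]]].
  by exists j, m; split=> //; lia.
by apply/eqP/prod_lam_eq0; exists j, m; split=> //; lia.
Qed.

Lemma horn_Q_eq0 i a :
  horn_Q B c i a = 0 <-> exists j (m : nat), lam j a = m%:R /\ m%:Z - B j i < 0.
Proof.
split=> [/eqP/prod_lam_eq0[j [m [? ? ?]]]|[j [m [? ?]]]].
  by exists j, m; split=> //; lia.
by apply/eqP/prod_lam_eq0; exists j, m; split=> //; lia.
Qed.

Lemma horn_eq f i a : puiseux_sol B c f ->
  horn_Q B c i (translate i 1 a) * f (translate i 1 a) = horn_P B c i a * f a.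
Proof.
case=> _ /(_ i (translate i 1 a)) /eqP.
by rewrite /horn_H shiftE translateD addNr translate0 subr_eq0 => /eqP.
Qed.

(* The support of a solution can only be left through a step that makes some
   nonnegative integer value [lam j] negative. *)
Lemma support_step f a i sg : signs sg -> puiseux_sol B c f -> f a != 0 ->
    (forall j (m : nat), lam j a = m%:R -> 0 <= m%:Z + B j i * sg) ->
  f (translate i sg a) != 0 /\
  (forall j (m : nat), lam j (translate i sg a) = m%:R -> 0 <= m%:Z - B j i * sg).
Proof.
move=> sgP fsol fa h; case: sgP h => -> h.
  have P0 : horn_P B c i a != 0.
    by apply/eqP => /horn_P_eq0[j [m [/h]]]; rewrite mulr1; lia.
  have : horn_P B c i a * f a != 0 by rewrite mulf_neq0.
  rewrite -horn_eq // mulf_eq0 negb_or => /andP[Q0 f1]; split=> // j m lm.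
  rewrite leNgt; apply: contra_neqN Q0 => mB; apply/horn_Q_eq0; exists j, m.
  by rewrite -[B j i]mulr1.
have Q0 : horn_Q B c i a != 0.
  by apply/eqP => /horn_Q_eq0[j [m [/h]]]; lia.
have : horn_Q B c i a * f a != 0 by rewrite mulf_neq0.
have := horn_eq i (translate i (-1) a) fsol.
rewrite translateD subrr translate0 => ->.
rewrite mulf_eq0 negb_or => /andP[P0 f1]; split=> // j m lm.
rewrite leNgt; apply: contra_neqN P0 => mB; apply/horn_P_eq0; exists j, m.
by split=> //; lia.
Qed.

(** Otherwise the whole ray from [a] in this direction would lie in the finite support. *)
Lemma support_blocked f a i sg : signs sg -> puiseux_sol B c f -> f a != 0 ->
  exists j (m : nat), lam j a = m%:R /\ B j i * sg < 0.
Proof.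
move=> sgP fsol fa; apply: contrapT => noblock.
(* Invariant along the ray: the support is not left, and no row with a natural value decreases. *)
have S x : f (translate i (sg * x%:Z) a) != 0 /\
    forall j (m : nat), lam j (translate i (sg * x%:Z) a) = m%:R -> 0 <= B j i * sg.
  elim: x => [|x [fx Nx]].
    rewrite mulr0 translate0; split=> // j m lm; rewrite leNgt; apply/negP => h.
    by apply: noblock; exists j, m.
  have [|] := support_step sgP fsol fx (i := i).
    by move=> j m /Nx h; rewrite addr_ge0.
  rewrite translateD -[X in X + _]mulr1 -mulrDr -intS => f1 N1; split=> // j m lm.
  (* [support_step] makes the preceding value natural too, so the invariant at [x] applies. *)
  have h := N1 j m lm; apply: (Nx j (absz (m%:Z - B j i * sg)%R)).
  move: lm; rewrite -[X in lam j X](translate0 i) -(subrr (sg * x%:Z)).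
  rewrite !lam_translate => lm.
  rewrite [RHS]pmulrn gez0_abs // rmorphB /= -pmulrn -lm intS !mulrDr !rmorphD /= !rmorphM /=.
  by ring.
have [[s sP] _] := fsol.
pose t := [seq translate i (sg * x%:Z) a | x <- iota 0 (size s).+1].
have ut : uniq t.
  rewrite map_inj_uniq ?iota_uniq // => x y /translate_inj.
  by case: sgP => -> ; lia.
have := uniq_leq_size ut (s2 := s); rewrite size_map size_iota ltnn.
by move=> /(_ _) h; apply/notF/h => _ /mapP[x _ ->]; apply: sP; case: (S x).
Qed.

(** The relation between the rows cancels [a] and leaves an integer relation on [c], in which [c l]
    has the nonzero coefficient [z]. The case [j = k] is allowed and serves for two dependent
    rows. *)
Lemma generic_independence j k l (x y z : int) a (u v w : int) :
    ~ integer_relation c -> l != j -> l != k -> z != 0 ->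
    (forall i, x * B j i + y * B k i + z * B l i = 0) ->
    lam j a = u%:~R -> lam k a = v%:~R -> lam l a = w%:~R -> False.
Proof.
move=> gen lj lk z0 rel lamj lamk laml; apply: gen.
pose d (h m : 'I_n) : int := if m == h then 1 else 0 : int.
exists [ffun m : 'I_n => x * d j m + y * d k m + z * d l m].
split.
  apply/eqP => /ffunP/(_ l); rewrite !ffunE /d (negbTE lj) (negbTE lk) eqxx.
  by rewrite !mulr0 !add0r mulr1; apply/eqP.
exists (x * u + y * v + z * w).
have sumd h (e : int) : \sum_m (e * d h m)%:~R * c m = e%:~R * c h.
  rewrite (bigD1 h) //= big1 ?addr0 /d ?eqxx ?mulr1 // => m /negbTE ->.
  by rewrite mulr0 mul0r.
under eq_bigr => m _ do rewrite ffunE !rmorphD /= !mulrDl.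
rewrite !big_split /= !sumd !rmorphD !rmorphM /= -lamj -lamk -laml /horn_lin.
have /(congr1 (fun e : int => e%:~R : C)) := rel 0.
have /(congr1 (fun e : int => e%:~R : C)) := rel 1.
rewrite !rmorphD !rmorphM /= rmorph0 => r1 r0.
set X0 := (X in X = 0) in r0; set X1 := (X in X = 0) in r1.
(* Subtracting [a.1] and [a.2] times the two vanishing column sums reduces the goal to a ring
   identity. *)
rewrite -[RHS]subr0 -[X in _ - X](mul0r a.1) -[X in _ - X * _]r0.
rewrite -[RHS]subr0 -[X in _ = _ - X](mul0r a.2) -[X in _ = _ - X * _]r1 /X0 /X1.
by ring.
Qed.

Definition minor j k : int := B j 0 * B k 1 - B j 1 * B k 0.

Lemma generic_pair j k i a (u v : int) :
    ~ integer_relation c -> j != k -> B j i != 0 ->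
    lam j a = u%:~R -> lam k a = v%:~R -> minor j k != 0.
Proof.
move=> gen jk Bj lamj lamk; apply/eqP => m0.
apply: (@generic_independence j j k (- B k i) 0 (B j i) a u u v) => //; rewrite 1?eq_sym //.
move=> i'; move: m0; rewrite /minor.
by case: (ord2P i) => ->; case: (ord2P i') => -> m0; rewrite mul0r; lia.
Qed.

(** Cramer's relation among three vectors of the plane, with the 2 by 2 minors as coefficients. *)
Lemma generic_triple j k l a (u v w : int) :
    ~ integer_relation c -> minor j k != 0 -> l != j -> l != k ->
    lam j a = u%:~R -> lam k a = v%:~R -> lam l a = w%:~R -> False.
Proof.
move=> gen jk lj lk; apply: (generic_independence (x := minor k l) (y := minor l j)) jk _ => //.
by move=> i; rewrite /minor; case: (ord2P i) => ->; ring.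
Qed.

(** The rows blocking the two directions of one axis are distinct, and genericity allows only two
    blocking rows in all. The same two thus block both axes, with opposite signs in each column. *)
Lemma support_in_cone f a : ~ integer_relation c -> puiseux_sol B c f -> f a != 0 ->
  exists j k (u v : nat), [/\ (j < k)%N, lin_indep_rows B j k, opp_quadrants B j k,
    lam j a = u%:R & lam k a = v%:R].
Proof.
move=> gen fsol fa.
have s1 : signs 1 by left. have sN1 : signs (-1) by right.
have [j [u [lamj Bj]]] := support_blocked 0 s1 fsol fa.
have [k [v [lamk Bk]]] := support_blocked 0 sN1 fsol fa.
have [l [w [laml Bl]]] := support_blocked 1 s1 fsol fa.
have [l' [w' [laml' Bl']]] := support_blocked 1 sN1 fsol fa.
have jk : j != k by apply/eqP => jk; subst k; lia.
have ll' : l != l' by apply/eqP => h; subst l'; lia.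
have m0 : minor j k != 0.
  by apply: (@generic_pair j k 0 a u v) => //; lia.
have mem h (x : nat) : lam h a = x%:R -> h = j \/ h = k.
  move=> lamh; case: (eqVneq h j) => [|hj]; first by left.
  case: (eqVneq h k) => [|hk]; first by right.
  by case: (@generic_triple j k h a u v x).
have opp : opp_quadrants B j k.
  rewrite /opp_quadrants; case: (mem _ _ laml) ll' Bl => -> ll' Bl;
  case: (mem _ _ laml') ll' Bl' => ->; rewrite ?eqxx // => _ Bl';
  apply/and4P; split; lia.
have opp' : opp_quadrants B k j by move: opp; rewrite /opp_quadrants; lia.
move: m0; rewrite /minor => m0.
case: (ltngtP j k) => [lt|lt|/val_inj E]; last by rewrite E eqxx in jk.
  by exists j, k, u, v.
by exists k, j, v, u; split=> //; rewrite /lin_indep_rows; lia.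
Qed.

End Solutions.

(** * Solutions supported on the cone of two opposite rows *)

Section Cone.
Variables (R : realType) (n : nat) (B : 'M[int]_(n, 2)) (c : 'I_n -> R[i]).
Variables (j k : 'I_n) (i1 i2 : 'I_2) (e1 e2 : int) (p q r s : nat).
Local Notation C := (R[i]).
Local Notation lam := (horn_lin B c).
Implicit Types (a : C * C) (w t : nat * nat).

(** [e1] and [e2] carry the signs of row [j]. Translation by [- e1] along [i1] becomes [move1], and
    by [e2] along [i2] becomes [move2]. *)
Hypotheses (gen : ~ integer_relation c) (i12 : i1 != i2) (e1P : signs e1) (e2P : signs e2).
Hypotheses (Bj1 : B j i1 = e1 * p%:Z) (Bj2 : B j i2 = e2 * q%:Z).
Hypotheses (Bk1 : B k i1 = - (e1 * r%:Z)) (Bk2 : B k i2 = - (e2 * s%:Z)).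
Hypothesis slopes : (p * s < q * r)%N.

Lemma cone_minor : minor B j k != 0.
Proof.
rewrite /minor; move: i12 Bj1 Bj2 Bk1 Bk2.
by case: (ord2P i1) => ->; case: (ord2P i2) => -> // _ -> -> -> ->;
  case: e1P => ->; case: e2P => ->; nia.
Qed.

Lemma axisP i : i = i1 \/ i = i2.
Proof.
by move: i12; case: (ord2P i) => ->; case: (ord2P i1) => ->; case: (ord2P i2) => -> //;
  auto.
Qed.

(** Cramer's rule for [lam j = w.1] and [lam k = w.2]. *)
Definition pt w : C * C :=
  let x := w.1%:R - c j in let y := w.2%:R - c k in
  (((B k 1)%:~R * x - (B j 1)%:~R * y) / (minor B j k)%:~R,
   ((B j 0)%:~R * y - (B k 0)%:~R * x) / (minor B j k)%:~R).

Let minorC : (B j 0)%:~R * (B k 1)%:~R - (B j 1)%:~R * (B k 0)%:~R != 0 :> C.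
Proof. by rewrite -!rmorphM -rmorphB intr_eq0 cone_minor. Qed.

Lemma lam_pt w : lam j (pt w) = w.1%:R /\ lam k (pt w) = w.2%:R.
Proof.
by rewrite /horn_lin /pt /minor /= !rmorphB !rmorphM /=; split; field.
Qed.

Lemma pt_eq a w : lam j a = w.1%:R -> lam k a = w.2%:R -> a = pt w.
Proof.
move=> lamj lamk; rewrite /pt -lamj -lamk /horn_lin /minor /= !rmorphB !rmorphM /=.
by case: a {lamj lamk} => a1 a2 /=; congr pair; field.
Qed.

Lemma lam_pt_translate w w' i sg :
    w.1%:Z + B j i * sg = w'.1 -> w.2%:Z + B k i * sg = w'.2 ->
  translate i sg (pt w) = pt w'.
Proof.
move=> h1 h2; have [lamj lamk] := lam_pt w.
by apply: pt_eq; rewrite lam_translate ?lamj ?lamk pmulrn -rmorphD /= ?h1 ?h2.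
Qed.

Lemma pt_translate_lam w w' i sg :
    lam j (translate i sg (pt w)) = w'.1%:R -> lam k (translate i sg (pt w)) = w'.2%:R ->
  w.1%:Z + B j i * sg = w'.1 /\ w.2%:Z + B k i * sg = w'.2.
Proof.
have [lamj lamk] := lam_pt w.
by rewrite !lam_translate lamj lamk !pmulrn -!rmorphD /= => /intr_inj ? /intr_inj ?.
Qed.

Lemma pt_move1 w : (p <= w.1)%N -> translate i1 (- e1) (pt w) = pt (move1 p r w).
Proof.
move=> pw; apply: lam_pt_translate; rewrite /= ?Bj1 ?Bk1; case: e1P => ->; lia.
Qed.

Lemma pt_move2 w : (s <= w.2)%N -> translate i2 e2 (pt w) = pt (move2 q s w).
Proof.
move=> pw; apply: lam_pt_translate; rewrite /= ?Bj2 ?Bk2; case: e2P => ->; lia.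
Qed.

(** Every axis step between points of the quarter plane is a move or the reverse of one. *)
Lemma reaches_step t w w' i sg : signs sg -> terminal p s t ->
    w.1%:Z + B j i * sg = w'.1 -> w.2%:Z + B k i * sg = w'.2 ->
  reaches p q r s t w -> reaches p q r s t w'.
Proof.
move=> sgP tt; case: w w' => u v [u' v'] /=; case: (axisP i) => ->.
  rewrite Bj1 Bk1; have [-> h1 h2 | -> h1 h2] : sg = - e1 \/ sg = e1.
      by case: sgP => ->; case: e1P => ->; auto.
    have pu : (p <= u)%N by move: h1 h2; case: e1P => ->; lia.
    rewrite -(reaches_move1 q r tt (w := (u, v))) //.
    suff -> : move1 p r (u, v) = (u', v') by [].
    by rewrite /move1 /=; congr pair; move: h1 h2; case: e1P => ->; lia.
  have pu : (p <= u')%N by move: h1 h2; case: e1P => ->; lia.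
  rewrite -(reaches_move1 q r tt (w := (u', v'))) //.
  suff -> : move1 p r (u', v') = (u, v) by [].
  by rewrite /move1 /=; congr pair; move: h1 h2; case: e1P => ->; lia.
rewrite Bj2 Bk2; have [-> h1 h2 | -> h1 h2] : sg = e2 \/ sg = - e2.
    by case: sgP => ->; case: e2P => ->; auto.
  have sv : (s <= v)%N by move: h1 h2; case: e2P => ->; lia.
  rewrite -(reaches_move2 q r tt (w := (u, v))) //.
  suff -> : move2 q s (u, v) = (u', v') by [].
  by rewrite /move2 /=; congr pair; move: h1 h2; case: e2P => ->; lia.
have sv : (s <= v')%N by move: h1 h2; case: e2P => ->; lia.
rewrite -(reaches_move2 q r tt (w := (u', v'))) //.
suff -> : move2 q s (u', v') = (u, v) by [].
by rewrite /move2 /=; congr pair; move: h1 h2; case: e2P => ->; lia.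
Qed.

Definition component t a := exists2 w, a = pt w & reaches p q r s t w.

(** On the component of [pt t] the difference is an integer, which the floor of its real part
    extracts. *)
Definition lam_floor t l a : int := Num.floor (complex.Re (lam l a - lam l (pt t))).

(* On the component of [pt t] this is [\prod_l 1 / Gamma (lam l a + 1)] up to a
   constant factor. *)
Definition cone_sol t a : C :=
  if `[< component t a >]
  then \prod_l invgamma (lam l (pt t)) (lam_floor t l a) else 0.

Lemma component_int t a l : component t a -> exists m : int, lam l a = lam l (pt t) + m%:~R.
Proof.
case=> w -> [d]; elim: d w => [|d IH] w /=.
  by move/eqP->; exists 0; rewrite addr0.
case/orP => /andP[h /IH[m]].
  rewrite -pt_move1 // lam_translate => E; exists (m - (B l i1 * - e1)).
  by rewrite rmorphB /= addrA -E addrK.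
rewrite -pt_move2 // lam_translate => E; exists (m - (B l i2 * e2)).
by rewrite rmorphB /= addrA -E addrK.
Qed.

(** [lam j] and [lam k] are natural here and genericity excludes a third integer value, so
    [invgamma] never inverts 0. *)
Lemma pt_not_negative t l (x : nat) : lam l (pt t) + x.+1%:R != 0.
Proof.
have [lamj lamk] := lam_pt t.
case: (eqVneq l j) => [->|lj]; first by rewrite lamj -natrD pnatr_eq0 addnS.
case: (eqVneq l k) => [->|lk]; first by rewrite lamk -natrD pnatr_eq0 addnS.
apply/eqP => /eqP; rewrite addr_eq0 => /eqP laml.
apply: (@generic_triple _ _ _ _ j k l (pt t) t.1 t.2 (- x.+1%:Z) gen cone_minor lj lk) => //.
Qed.

Lemma lam_floorE t l a (m : int) : lam l a = lam l (pt t) + m%:~R -> lam_floor t l a = m.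
Proof. by move=> E; rewrite /lam_floor E addrC addKr Re_int intrKfloor. Qed.

Lemma invgamma_lam_sub t l a a' (x : nat) : component t a -> lam l a' = lam l a - x%:R ->
  invgamma (lam l (pt t)) (lam_floor t l a') =
    \prod_(y < x) (lam l a - y%:R) * invgamma (lam l (pt t)) (lam_floor t l a).
Proof.
move=> /(component_int l)[m E] E'; rewrite (lam_floorE E) (@lam_floorE _ _ _ (m - x%:Z)).
  by rewrite invgamma_sub ?E //; apply: pt_not_negative.
by rewrite E' E rmorphB /= addrA.
Qed.

(** The equation holds row by row: positive entries give the factors of [horn_Q], negative ones
    those of [horn_P]. *)
Lemma component_edge t a i : component t a -> component t (shift i a) ->
  horn_Q B c i a * (\prod_l invgamma (lam l (pt t)) (lam_floor t l a)) =
  horn_P B c i (shift i a) *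
    (\prod_l invgamma (lam l (pt t)) (lam_floor t l (shift i a))).
Proof.
move=> ca ca'; rewrite /horn_Q /horn_P.
rewrite (big_mkcond (fun l => 0 < B l i)) (big_mkcond (fun l => B l i < 0)) -!big_split /=.
apply: eq_bigr => l _.
have E : lam l (shift i a) = lam l a - (B l i)%:~R.
  by rewrite shiftE lam_translate mulrN1 rmorphN.
case: (ltgtP (B l i) 0) => Bli.
- rewrite mul1r (@invgamma_lam_sub t l (shift i a) a `|B l i|%N) // E.
  by rewrite [X in _ = _ - X]pmulrn ltz0_abs // rmorphN opprK subrK.
- rewrite mul1r (@invgamma_lam_sub t l a (shift i a) `|B l i|%N) // E.
  by rewrite [X in _ = _ - X]pmulrn gtz0_abs.
- by rewrite /lam_floor E Bli subr0.
Qed.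

(** An edge that leaves the component leaves the quarter plane: [lam j] or [lam k] turns negative
    and the edge coefficient vanishes. *)
Lemma component_shift t a i : terminal p s t -> component t a ->
  component t (shift i a) \/ horn_Q B c i a = 0.
Proof.
move=> tt [w -> rw]; rewrite shiftE.
have [lamj lamk] := lam_pt w.
have [lj|lj] := ltP (w.1%:Z + B j i * -1) 0.
  by right; apply/horn_Q_eq0; exists j, w.1; split=> //; lia.
have [lk|lk] := ltP (w.2%:Z + B k i * -1) 0.
  by right; apply/horn_Q_eq0; exists k, w.2; split=> //; lia.
pose w' := (absz (w.1%:Z + B j i * -1)%R, absz (w.2%:Z + B k i * -1)%R).
have h1 : w.1%:Z + B j i * -1 = w'.1 by rewrite /= gez0_abs.
have h2 : w.2%:Z + B k i * -1 = w'.2 by rewrite /= gez0_abs.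
left; exists w'; first exact: lam_pt_translate.
by apply: (reaches_step _ tt h1 h2) => //; right.
Qed.

Lemma component_unshift t a i : terminal p s t -> component t (shift i a) ->
  component t a \/ horn_P B c i (shift i a) = 0.
Proof.
move=> tt [w aw rw].
have E : a = translate i 1 (pt w) by rewrite -aw shiftE translateD subrr translate0.
rewrite aw {aw}E.
have [lamj lamk] := lam_pt w.
have [lj|lj] := ltP (w.1%:Z + B j i * 1) 0.
  by right; apply/horn_P_eq0; exists j, w.1; split=> //; lia.
have [lk|lk] := ltP (w.2%:Z + B k i * 1) 0.
  by right; apply/horn_P_eq0; exists k, w.2; split=> //; lia.
pose w' := (absz (w.1%:Z + B j i * 1)%R, absz (w.2%:Z + B k i * 1)%R).
have h1 : w.1%:Z + B j i * 1 = w'.1 by rewrite /= gez0_abs.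
have h2 : w.2%:Z + B k i * 1 = w'.2 by rewrite /= gez0_abs.
left; exists w'; first exact: lam_pt_translate.
by apply: (reaches_step _ tt h1 h2) => //; left.
Qed.

Lemma cone_sol_support t a : cone_sol t a != 0 -> component t a.
Proof. by rewrite /cone_sol; case: asboolP => //; rewrite eqxx. Qed.

Lemma cone_sol_id t : cone_sol t (pt t) = 1.
Proof.
rewrite /cone_sol asboolT; last by exists t => //; exists 0%N => /=.
apply: big1 => l _; rewrite (@lam_floorE _ _ _ 0) ?addr0 //.
exact: big_ord0.
Qed.

Lemma cone_sol_terminal t w : terminal p s w -> cone_sol t (pt w) != 0 -> w = t.
Proof.
move=> tw /cone_sol_support[w' E rw']; have [/[!E] h1 h2] := lam_pt w.
have [h3 h4] := lam_pt w'.
have ww' : w = w'.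
  move: h1 h2; rewrite h3 h4 => /eqP; rewrite eqr_nat => /eqP h1.
  by move/eqP; rewrite eqr_nat => /eqP h2; case: w w' h1 h2 {tw E h3 h4 rw'} => ? ? [? ?] /= -> ->.
by apply: (reaches_terminal tw (q := q) (r := r)); rewrite ww'.
Qed.

Lemma cone_sol_puiseux t : terminal p s t -> puiseux_sol B c (cone_sol t).
Proof.
move=> tt; split.
  (* The weight bounds both coordinates, its coefficients being positive. *)
  pose M := (weight p q r s t).+1.
  exists [seq pt (u, v) | u <- iota 0 M, v <- iota 0 M] => a /cone_sol_support[[u v] -> ruv].
  have := reaches_weight slopes ruv; rewrite [X in (X <= _)%N]/weight [fst _]/= [snd _]/= => wM.
  have /andP[q0 r0] : (0 < q)%N && (0 < r)%N by rewrite -muln_gt0 (leq_ltn_trans _ slopes).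
  by apply/allpairsP; exists (u, v); split=> //; rewrite mem_iota /M /=; nia.
move=> i a; rewrite /horn_H; apply/eqP; rewrite subr_eq0; apply/eqP.
rewrite /cone_sol; case: asboolP => ca; case: asboolP => ca'.
- exact: component_edge.
- by case: (component_shift i tt ca) => // ->; rewrite mul0r mulr0.
- by case: (component_unshift tt ca') => // ->; rewrite mul0r mulr0.
- by rewrite !mulr0.
Qed.

(** A move stays in the support, since [lam j] and [lam k] remain natural and no third value is an
    integer. The weight grows, so the climb through the finite support ends at a terminal point. *)
Lemma cone_terminal_support (f : C * C -> C) w : puiseux_sol B c f -> f (pt w) != 0 ->
  exists2 t, terminal p s t & f (pt t) != 0.
Proof.
move=> fsol; have [[S fS] _] := fsol.
(* Defined at every point through real parts, because elements of [S] need not have the form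
   [pt w]. *)
pose W a := weight p q r s
  (Num.truncn (complex.Re (lam j a)), Num.truncn (complex.Re (lam k a))).
have Wpt w' : W (pt w') = weight p q r s w'.
  by rewrite /W; have [-> ->] := lam_pt w'; rewrite !pmulrn !Re_int -!pmulrn !natrK.
pose M := \max_(a <- S) W a.
have [m] := ubnP (M - weight p q r s w); elim: m w => // m IH w wm fw.
have wM : (weight p q r s w <= M)%N by rewrite -Wpt leq_bigmax_seq // fS.
have next i sg w' : signs sg -> (weight p q r s w < weight p q r s w')%N ->
    translate i sg (pt w) = pt w' -> exists2 t, terminal p s t & f (pt t) != 0.
  move=> sgP ww' E.
  have fw' : f (pt w') != 0.
    rewrite -E; case: (support_step sgP fsol fw (i := i)) => // l x laml.
    have [lamj lamk] := lam_pt w; have [lamj' lamk'] := lam_pt w'.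
    have [h1 h2] : w.1%:Z + B j i * sg = w'.1 /\ w.2%:Z + B k i * sg = w'.2.
      by apply: pt_translate_lam; rewrite E.
    case: (eqVneq l j) laml => [->|lj laml].
      by rewrite lamj => /eqP; rewrite eqr_nat => /eqP <-; rewrite h1.
    case: (eqVneq l k) laml => [->|lk laml].
      by rewrite lamk => /eqP; rewrite eqr_nat => /eqP <-; rewrite h2.
    by case: (@generic_triple _ _ _ _ j k l (pt w) w.1 w.2 x gen cone_minor lj lk).
  have w'M : (weight p q r s w' <= M)%N by rewrite -Wpt leq_bigmax_seq // fS.
  by apply: (IH w') => //; lia.
case: (leqP p w.1) => [pw|wp].
  apply: (next i1 (- e1)) (weight_move1 slopes pw) (pt_move1 pw).
  by case: e1P => ->; rewrite /signs; auto.
case: (leqP s w.2) => [sw|ws].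
  by apply: (next i2 e2) (weight_move2 slopes sw) (pt_move2 sw).
by exists w => //; rewrite /terminal wp.
Qed.

End Cone.

(** * The dimension count *)

Section Rank.
Variables (R : realType) (n : nat) (B : 'M[int]_(n, 2)) (c : 'I_n -> R[i]).
Local Notation C := (R[i]).
Local Notation lam := (horn_lin B c).
Implicit Types (a : C * C) (j k : 'I_n) (x : 'I_n * 'I_n).

Lemma puiseux_sol_sub (f g : C * C -> C) (z : C) :
  puiseux_sol B c f -> puiseux_sol B c g -> puiseux_sol B c (fun a => f a - z * g a).
Proof.
move=> [[s sP] fH] [[s' sP'] gH]; split.
  exists (s ++ s') => a; apply: contraR; rewrite mem_cat negb_or => /andP[as_ as'].
  rewrite (contraNeq (@sP a) as_) (contraNeq (@sP' a) as').
  by rewrite mulr0 subr0.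
move=> i a; have := fH i a; have := gH i a; rewrite /horn_H => g0 f0.
rewrite -[RHS]subr0 -{1}f0 -(mulr0 z) -g0; ring.
Qed.

Lemma puiseux_sol_sub_sum (I : Type) (r : seq I) (f : C * C -> C) (z : I -> C)
    (G : I -> C * C -> C) : puiseux_sol B c f -> (forall i, puiseux_sol B c (G i)) ->
  puiseux_sol B c (fun a => f a - \sum_(i <- r) z i * G i a).
Proof.
move=> fs Gs; elim: r => [|i r IH].
  rewrite (_ : (fun _ => _) = f) //; apply/funext => a.
  by rewrite big_nil subr0.
rewrite (_ : (fun _ => _) = fun a => (f a - \sum_(i <- r) z i * G i a) - z i * G i a).
  exact: puiseux_sol_sub.
by apply/funext => a; rewrite big_cons opprD addrCA addrC.
Qed.

(** Evaluations at the [P t] are coordinates dual to the [G t]: subtracting the combination with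
    coefficients [f (P t)] leaves a solution vanishing at every [P t]. *)
Lemma rank_p_dual_points (T : finType) (G : T -> C * C -> C) (P : T -> C * C) :
    (forall t, puiseux_sol B c (G t)) -> (forall t t', G t (P t') = (t == t')%:R) ->
    (forall f, puiseux_sol B c f -> (forall t, f (P t) = 0) -> forall a, f a = 0) ->
  rank_p_is B c #|T|.
Proof.
move=> Gs GP sep; exists (fun m => G (enum_val m)).
have ev (z : 'I_#|T| -> C) m :
    \sum_m' z m' * G (enum_val m') (P (enum_val m)) = z m.
  rewrite (bigD1 m) //= GP eqxx mulr1 big1 ?addr0 // => m' /negbTE m'm.
  by rewrite GP (inj_eq enum_val_inj) m'm mulr0.
split=> [m //|]; split=> [z z0 m|f fs]; first by rewrite -(ev z m).
exists (fun m => f (P (enum_val m))) => a; apply/eqP; rewrite -subr_eq0; apply/eqP.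
apply: (sep (fun a => f a - \sum_m f (P (enum_val m)) * G (enum_val m) a)) => [|t].
  exact: puiseux_sol_sub_sum.
by rewrite -[t]enum_rankK ev subrr.
Qed.

(* With this choice of axes [p s < q r] in the notation of the section [Cone]. *)
Definition axis1 j k : 'I_2 := if (`|(B j 0 * B k 1)%R| < `|(B k 0 * B j 1)%R|)%N then 0 else 1.
Definition axis2 j k : 'I_2 := if (`|(B j 0 * B k 1)%R| < `|(B k 0 * B j 1)%R|)%N then 1 else 0.

Lemma opposite_rows j k : lin_indep_rows B j k -> opp_quadrants B j k ->
  let i1 := axis1 j k in let i2 := axis2 j k in
  [/\ i1 != i2, exists e1 e2 : int, [/\ signs e1 /\ signs e2,
        B j i1 = e1 * `|B j i1|%N, B j i2 = e2 * `|B j i2|%N,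
        B k i1 = - (e1 * `|B k i1|%N) & B k i2 = - (e2 * `|B k i2|%N)],
      (`|B j i1| * `|B k i2| < `|B j i2| * `|B k i1|)%N
    & (`|B j i1| * `|B k i2|)%N = nu B j k].
Proof.
rewrite /lin_indep_rows /opp_quadrants /nu /axis1 /axis2 => det opp.
have sgE (i : 'I_2) : B j i != 0 -> sgz (B k i) = - sgz (B j i) ->
    exists e : int, [/\ signs e, B j i = e * `|B j i|%N & B k i = - (e * `|B k i|%N)].
  move=> b0 sg; exists (sgz (B j i)); split.
  - by rewrite /signs; case: sgzP b0 => //; auto.
  - by case: sgzP => h; lia.
  - by move: sg; case: sgzP => h; case: sgzP => h'; lia.
case/and4P: opp => b0 b1 /eqP s0 /eqP s1.
have [e [eP ej ek]] := sgE _ b0 s0; have [e' [eP' ej' ek']] := sgE _ b1 s1.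
(* Opposite quadrants give both products the same sign, so equal absolute values would make the
   determinant vanish. *)
have ne : `|(B j 0 * B k 1)%R|%N <> `|(B k 0 * B j 1)%R|%N.
  rewrite !abszM => h; case/eqP: det; rewrite ej ek ej' ek'.
  by case: eP => ->; case: eP' => ->; nia.
case: ltnP => h; split => //.
- by exists e, e'.
- by rewrite -!abszM [X in (_ < X)%N]abszM mulnC -abszM.
- by rewrite abszM.
- by exists e', e.
- move: h ne; rewrite !abszM [X in (X < _)%N]mulnC ltn_neqAle eq_sym.
  by move=> -> /eqP ->.
- by rewrite mulnC abszM.
Qed.

Definition cone_pair x :=
  [&& (x.1 < x.2)%N, lin_indep_rows B x.1 x.2 & opp_quadrants B x.1 x.2].
(** The value 0 off the admissible pairs lets [terminal_index] range over all pairs. *)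
Definition width x := if cone_pair x then `|B x.1 (axis1 x.1 x.2)|%N else 0%N.
Definition height x := if cone_pair x then `|B x.2 (axis2 x.1 x.2)|%N else 0%N.

Definition terminal_index := {x : 'I_n * 'I_n & ('I_(width x) * 'I_(height x))%type}.

Lemma card_terminal_index : #|{: terminal_index}| = nu_sum B.
Proof.
rewrite card_tagged sumnE big_map big_enum /= /nu_sum pair_big_dep /=.
rewrite [RHS]big_mkcond /=; apply: eq_bigr => x _.
rewrite card_prod !card_ord /width /height /cone_pair -andbA.
case: ifP => [/and3P[_ li opp]|//].
by have [_ _ _ ->] := opposite_rows li opp.
Qed.

Definition index_pair (t : terminal_index) : nat * nat :=
  (nat_of_ord (tagged t).1, nat_of_ord (tagged t).2).
Definition index_pt (t : terminal_index) := pt B c (tag t).1 (tag t).2 (index_pair t).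
Definition index_sol (t : terminal_index) :=
  let: (j, k) := tag t in let i1 := axis1 j k in let i2 := axis2 j k in
  cone_sol B c j k `|B j i1|%N `|B j i2|%N `|B k i1|%N `|B k i2|%N (index_pair t).

Lemma index_pairP (t : terminal_index) : cone_pair (tag t) /\
  terminal `|B (tag t).1 (axis1 (tag t).1 (tag t).2)|%N
           `|B (tag t).2 (axis2 (tag t).1 (tag t).2)|%N (index_pair t).
Proof.
case: t => x [u v]; rewrite /index_pair /terminal /=.
move: (nat_of_ord u) (nat_of_ord v) (ltn_ord u) (ltn_ord v) => {u v} u v.
by rewrite /width /height; case: ifP => // _ -> ->.
Qed.

Lemma index_inj (t t' : terminal_index) :
  tag t = tag t' -> index_pair t = index_pair t' -> t = t'.
Proof.
case: t t' => x [u v] [x' [u' v']] /= xx'; subst x'.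
by case=> /val_inj -> /val_inj ->.
Qed.

Hypothesis gen : ~ integer_relation c.

Lemma rank_p_generic : rank_p_is B c (nu_sum B).
Proof.
rewrite -card_terminal_index.
apply: (@rank_p_dual_points _ index_sol index_pt).
- move=> t; have [] := index_pairP t; rewrite /index_sol; case: (tag t) => j k /=.
  case/and3P=> _ li opp tt.
  have [ne [e1 [e2 [[? ?] ? ? ? ?]]] lt _] := opposite_rows li opp.
  exact: (@cone_sol_puiseux _ _ _ _ _ _ (axis1 j k) (axis2 j k) e1 e2).
- move=> t t'; have [ct tt] := index_pairP t; have [ct' tt'] := index_pairP t'.
  case: (eqVneq t t') => [<-|ne].
    by rewrite /index_sol /index_pt; case: (tag t) => j k; rewrite cone_sol_id.
  apply/eqP; apply: contraT => supp; case/negP: ne; move: supp ct tt.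
  rewrite /index_sol; case E: (tag t) => [j k] /= supp /and3P[/= jk li opp] tt.
  have [ne [e1 [e2 [[s1 s2] E1 E2 E3 E4]]] lt _] := opposite_rows li opp.
  have [w ptw rw] := cone_sol_support supp.
  have m0 := cone_minor ne s1 s2 E1 E2 E3 E4 lt.
  have [lamj lamk] := lam_pt c ne s1 s2 E1 E2 E3 E4 lt w.
  (* On the component for [(j, k)] no other row has a natural value; the ordering of the indices
     then fixes the pair. *)
  have E' : tag t' = (j, k).
    have lamN : exists x y : nat,
        lam (tag t').1 (index_pt t') = x%:R /\ lam (tag t').2 (index_pt t') = y%:R.
      have /and3P[_ li' opp'] := ct'.
      have [ne' [f1 [f2 [[s1' s2'] F1 F2 F3 F4]]] lt' _] := opposite_rows li' opp'.
      exists (index_pair t').1, (index_pair t').2.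
      exact: (lam_pt c ne' s1' s2' F1 F2 F3 F4 lt').
    have mem l (x : nat) : lam l (index_pt t') = x%:R -> l = j \/ l = k.
      rewrite ptw => laml; case: (eqVneq l j) => [|lj]; first by left.
      case: (eqVneq l k) => [|lk]; first by right.
      by case: (@generic_triple _ _ B c j k l _ w.1 w.2 x gen m0 lj lk lamj lamk laml).
    have [x [y [/mem j' /mem k']]] := lamN; case/and3P: ct' => jk' _ _.
    by case: (tag t') j' k' jk' => ? ? /= [] -> [] -> //; lia.
  move: supp; rewrite /index_pt E' /= => supp; apply/eqP/index_inj; first by rewrite E E'.
  by rewrite -(cone_sol_terminal ne s1 s2 E1 E2 E3 E4 lt _ supp) //; move: tt'; rewrite E'.
(* Any support point of [f] lies in some cone and leads to a terminal point of the support,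
   contradicting [f0]. *)
move=> f fs f0 a; apply/eqP; apply: contraT => fa.
have [j [k [u [v [jk li opp lamj lamk]]]]] := support_in_cone gen fs fa.
have [ne [e1 [e2 [[s1 s2] E1 E2 E3 E4]]] lt _] := opposite_rows li opp.
have aE : a = pt B c j k (u, v) by apply: (pt_eq ne s1 s2 E1 E2 E3 E4 lt).
rewrite aE in fa.
have [[x y] /andP[/= xp ys] /negP[]] :=
  cone_terminal_support gen ne s1 s2 E1 E2 E3 E4 lt fs fa.
have cjk : cone_pair (j, k) by rewrite /cone_pair /= jk li opp.
have xw : (x < width (j, k))%N by rewrite /width cjk.
have yh : (y < height (j, k))%N by rewrite /height cjk.
by apply/eqP; apply: (f0 (existT _ (j, k) (Ordinal xw, Ordinal yh))).
Qed.

End Rank.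

Theorem theorem6p6 (R : realType) (n : nat) (B : 'M[int]_(n, 2)) :
  (2 < n)%N ->
  \rank (map_mx (intr : int -> rat) B) = 2%N ->
  (forall i : 'I_2, \sum_(j < n) B j i = 0) ->
  exists E : ('I_n -> R[i]) -> Prop,
    null_set E /\
    forall c : 'I_n -> R[i], ~ E c -> rank_p_is B c (nu_sum B).
Proof.
move=> n2 _ _; exists (@integer_relation R n); split.
  by apply: null_integer_relation; apply: (Ordinal (ltn_trans (ltnSn 1) n2)).
exact: rank_p_generic.
Qed.
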